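(* Let $c_1,c_2,a\in[0,1]$. Suppose two events $D_1,D_2$ are generated as follows: with probability $1-a$, both are generated from one shared random variable $U$ uniform on $[0,1]$, $D_i$ occurring if and only if $U<c_i$ ($i=1,2$); with probability $a$, they are generated independently of each other with $P(D_1)=c_1$ and $P(D_2)=c_2$. Then $$P(D_1\cup D_2)=\max(c_1,c_2)+a\bigl(c_1+c_2-c_1c_2-\max(c_1,c_2)\bigr).$$
   Context: The choice between the shared and the independent generation is made at random, independently of the uniform variables used. The right-hand side is called the cumulation rule $\mathrm{cumul}(c_1,c_2;a)$; $D_i$ is the event that derivation (reasoning chain) $i$ holds, and $c_i$ is its probability. *)

(* Defs.v *)
From HB Require Import structures.
From mathcomp Require Import all_boot all_order all_algebra.
From mathcomp Require Import all_classical all_reals all_analysis.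
Import Order.TTheory GRing.Theory Num.Theory.

Set Implicit Arguments.
Unset Strict Implicit.
Unset Printing Implicit Defensive.

Local Open Scope classical_set_scope.
Local Open Scope ring_scope.

Definition independent_events d (T : measurableType d) (R : realType)
    (P : probability T R) (A B : set T) : Prop :=
  (P (A `&` B) = P A * P B)%E.

(* Independence of the sigma-algebras generated by X and Y. *)
Definition independent_RVs d d1 d2 (T : measurableType d)
    (T1 : measurableType d1) (T2 : measurableType d2) (R : realType)
    (P : probability T R) (X : T -> T1) (Y : T -> T2) : Prop :=
  forall (A : set T1) (B : set T2), measurable A -> measurable B ->
    independent_events P (X @^-1` A) (Y @^-1` B).

(* [uniform_prob ltr01] is the uniform law on [0, 1]; it is a set function on
   all of [set R], hence the restriction to measurable sets. *)
Definition uniform01 d (T : measurableType d) (R : realType)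
    (P : probability T R) (U : {RV P >-> R}) : Prop :=
  forall A : set R, measurable A ->
    distribution P U A = uniform_prob (@ltr01 R) A.

(* [C w] selects the mode of generation: when it is [true] the event is decided
   by its own indicator [B], when it is [false] by the threshold test on the
   shared variable [U]. *)
Definition generated_event (T : Type) (R : realType)
    (C : T -> bool) (U : T -> R) (B : T -> bool) (c : R) : set T :=
  [set w | if C w then B w else U w < c].

(* Main.v *)
(** Generating the union is itself a single generation: its independent mode
    uses [B1 || B2], of probability c1 + c2 - c1 c2, and its shared mode uses
    the threshold [max c1 c2]. Conditioning on the mode [C] then gives
    a (c1 + c2 - c1 c2) + (1 - a) max c1 c2. *)
Require Import Defs.
From HB Require Import structures.
From mathcomp Require Import all_boot all_order all_algebra.
From mathcomp Require Import all_classical all_reals all_analysis.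
From mathcomp Require Import ring.
Import Order.TTheory GRing.Theory Num.Theory.
Local Open Scope classical_set_scope.
Local Open Scope ring_scope.

(** The density vanishes off [[0, 1]] and is 1 on it, so the integral reduces to the length of [[0,
    c[], which lies in the support since [c <= 1]. *)
Lemma uniform01_lt d (T : measurableType d) (R : realType)
    (P : probability T R) (U : {RV P >-> R}) (c : R) :
  uniform01 U -> 0 <= c <= 1 -> P [set w | U w < c] = c%:E.
Proof.
move=> hU /andP[c0 c1].
have -> : P [set w | U w < c] = distribution P U `]-oo, c[ by [].
rewrite hU// /uniform_prob integral_uniform_pdf.
have -> : `]-oo, c[ `&` `[0, 1] = `[0, c[%classic.
  apply/seteqP; split=> x /=; rewrite !in_itv/=.
    by move=> [-> /andP[->]].
  by move=> /andP[-> xc]; rewrite xc (ltW (lt_le_trans xc c1)).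
rewrite (eq_integral (fun=> 1%:E)); last first.
  move=> x; rewrite inE/= in_itv/= /uniform_pdf => /andP[-> xc].
  by rewrite (ltW (lt_le_trans xc c1)) subr0 invr1.
rewrite integral_cst//= mul1e lebesgue_measure_itv/= lte_fin.
(* The length formula is a conditional on [0 < c]; the empty interval [c = 0] is its other
   branch. *)
by case: ltgtP c0 => // [_|<-]; rewrite ?sube0.
Qed.

(** Both events read the same [C w], so the union passes inside each mode; lying below one of two
    thresholds means lying below the larger. *)
Lemma generated_eventU (T : Type) (R : realType) (C : T -> bool) (U : T -> R)
    (B1 B2 : T -> bool) (c1 c2 : R) :
  generated_event C U B1 c1 `|` generated_event C U B2 c2 =
  generated_event C U (fun w => B1 w || B2 w) (Num.max c1 c2).
Proof.
apply/seteqP; split=> w /=; rewrite /generated_event/=; case: (C w);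
  by rewrite ?lt_max => /orP.
Qed.

(** Splitting by mode gives two disjoint pieces, each an intersection to which independence from [C]
    applies. *)
Lemma generated_eventE (T : Type) (R : realType) (C : T -> bool) (U : T -> R)
    (B : T -> bool) (c : R) :
  generated_event C U B c =
  ([set w | C w] `&` [set w | B w]) `|` (~` [set w | C w] `&` [set w | U w < c]).
Proof.
apply/seteqP; split=> w /=; rewrite /generated_event/=; case: (C w) => /=.
- by left.
- by right.
- by case=> -[].
- by case=> -[].
Qed.

Theorem mainTheorem4 (R : realType) (d : measure_display)
    (T : measurableType d) (P : probability T R)
    (c1 c2 a : R)
    (hc1 : 0 <= c1 <= 1) (hc2 : 0 <= c2 <= 1) (ha : 0 <= a <= 1)
    (C : {RV P >-> bool}) (U : {RV P >-> R}) (B1 B2 : {RV P >-> bool})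
    (hC : P [set w | C w] = a%:E)
    (hU : uniform01 U)
    (hB1 : P [set w | B1 w] = c1%:E)
    (hB2 : P [set w | B2 w] = c2%:E)
    (hB : independent_events P [set w | B1 w] [set w | B2 w])
    (hind : independent_RVs P C (fun w => (U w, (B1 w, B2 w))))
    (D1 D2 : set T)
    (hD1 : D1 = generated_event C U B1 c1)
    (hD2 : D2 = generated_event C U B2 c2) :
  P (D1 `|` D2) =
    (Num.max c1 c2 + a * (c1 + c2 - c1 * c2 - Num.max c1 c2))%:E.
Proof.
have mB (B : {RV P >-> bool}) : measurable [set w | B w].
  by rewrite -[X in measurable X]setTI; exact: (measurable_funP B).
have mU c : measurable [set w | U w < c].
  rewrite -[X in measurable X]setTI.
  rewrite (_ : [set w | U w < c] = U @^-1` `]-oo, c[).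
    exact: measurable_funP.
  by apply/seteqP; split=> w /=; rewrite in_itv.
set m := Num.max c1 c2.
have hm : 0 <= m <= 1 by rewrite /m; case: (leP c1 c2).
have B12 : [set w | B1 w || B2 w] = [set w | B1 w] `|` [set w | B2 w].
  by apply/seteqP; split=> w /=; [move/orP|move=> ?; exact/orP].
have PB : P [set w | B1 w || B2 w] = (c1 + c2 - c1 * c2)%:E.
  (* Inclusion-exclusion, with finiteness required for the subtraction in extended reals; [hB] then
     factors the intersection. *)
  rewrite B12 measureUfinl//; last by rewrite [ltLHS]hB1 ltry.
  rewrite EFinB EFinD EFinM; congr (_ + _ - _)%E => //.
  by rewrite -hB1 -hB2.
have PCB : (P ([set w | C w] `&` [set w | B1 w || B2 w]) =
    a%:E * (c1 + c2 - c1 * c2)%:E)%E.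
  rewrite -PB -hC.
  (* The disjunction is the preimage under [(U, (B1, B2))] of a set that leaves [U] free, so the
     joint independence from [C] covers it. *)
  have := hind [set true]
    (setT `*` ([set true] `*` setT `|` setT `*` [set true])).
  rewrite /independent_events.
  rewrite (_ : _ @^-1` (_ `*` _) = [set w | B1 w || B2 w]); last first.
    apply/seteqP; split=> w /=.
      by move=> [_ [[->]|[_ ->]]]; rewrite ?orbT.
    by case/orP => h; split=> //; [left|right].
  by apply=> //; apply: measurableX => //; apply: measurableU;
    exact: measurableX.
have PCU : (P (~` [set w | C w] `&` [set w | (U w < m)%R]) =
    (1 - a)%:E * m%:E)%E.
  have -> : (1 - a)%:E = P (~` [set w | C w]).
    by rewrite probability_setC// hC.
  rewrite -(uniform01_lt _ _ _ _ _ _ hU hm).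
  (* The preimage of [[set~ true]] under [C] is the shared mode; the second set constrains only
     [U]. *)
  have := hind [set~ true] (`]-oo, m[ `*` setT).
  rewrite /independent_events.
  rewrite (_ : _ @^-1` (_ `*` _) = [set w | U w < m]); last first.
    by apply/seteqP; split=> w /=; rewrite in_itv//= => -[].
  by apply=> //; exact: measurableX.
rewrite hD1 hD2 generated_eventU generated_eventE measureU//.
- rewrite [X in (X + _)%E]PCB [X in (_ + X)%E]PCU -!EFinM -EFinD; congr EFin.
  by rewrite -/m; ring.
- by apply: measurableI => //; rewrite B12; exact: measurableU.
- by apply: measurableI => //; exact: measurableC.
(* Disjointness: regrouping the four factors pairs the mode with its complement. *)
- by rewrite setIACA setICr set0I.
Qed.
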